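(* Let $(\omega(e))_{e\in\mathcal{E}}$ be independent random variables indexed by the directed edges of the oriented half-plane lattice $\mathbb{H}$, where $\omega(e)$ is exponentially distributed with rate $2^{-h(e)}$ (mean $2^{h(e)}$), and let $\mathbb{P}$ denote their joint law. For $x\in\partial\mathbb{H}$ let $\hat T(x)$ be the tree of oriented first passage geodesics to $\partial\mathbb{H}$ rooted at $x$. Then almost surely all the trees are finite, i.e. $$\mathbb{P}\big(|\hat T(0)|<\infty\big)=1 .$$
   Context: **Lattice.** $\mathbb{H}=\{(x,y)\in\mathbb{Z}^2: x+y\in 2\mathbb{Z},\ y\ge 0\}$, $\theta_l=(-1,1)$, $\theta_r=(1,1)$. It is a directed graph: each $v\in\mathbb{H}$ has exactly the outgoing edges $(v,v+\theta_l)$ and $(v,v+\theta_r)$; $\mathcal{E}$ is the set of directed edges. For $v=(x,y)$, $h(v)=y$; for an edge $e=(v,w)$, $h(e)=\max\{h(v),h(w)\}$. $\partial\mathbb{H}=\{(x,0):x\in 2\mathbb{Z}\}$, and $0=(0,0)\in\partial\mathbb{H}$. **First passage percolation.** An oriented path is a finite sequence of consecutive directed edges $\gamma=(e_1,\dots,e_n)$; its length is $\lambda(\gamma)=\sum_{i=1}^n\omega(e_i)$. If there is an oriented path from $x$ to $y$, $d_\omega(x,y)=\min_{\gamma:x\to y}\lambda(\gamma)$, the minimum over the finitely many oriented paths from $x$ to $y$. For $y\in\mathbb{H}$, $d_\omega(y,\partial\mathbb{H})$ is the minimum of $d_\omega(x,y)$ over those $x\in\partial\mathbb{H}$ from which $y$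 can be reached by an oriented path. For $x\in\partial\mathbb{H}$, $$\hat T(x)=\bigcup_{y\in\mathbb{H}}\{\gamma:\ \gamma\text{ is an oriented path from }x\text{ to }y,\ \lambda(\gamma)=d_\omega(y,\partial\mathbb{H})\},$$ i.e. the set of edges lying on some oriented path that starts at $x$ and minimizes the distance of its endpoint to $\partial\mathbb{H}$; $|\hat T(x)|$ is its number of edges. (Almost surely the minimizing path to each $y$ is unique.) *)

(* Defs.v *)
From HB Require Import structures.
From mathcomp Require Import all_boot all_order all_algebra.
From mathcomp Require Import finmap.
From mathcomp Require Import all_classical all_reals all_analysis.

Set Implicit Arguments.
Unset Strict Implicit.
Unset Printing Implicit Defensive.

Import Order.TTheory GRing.Theory Num.Theory.
Import numFieldNormedType.Exports.

Local Open Scope classical_set_scope.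
Local Open Scope ring_scope.

Definition in_half_plane (v : int * int) : bool :=
  (2 %| v.1 + v.2)%Z && (0 <= v.2).

Definition vertex : Type := {v : int * int | in_half_plane v}.

Definition theta_l : int * int := (-1, 1).
Definition theta_r : int * int := (1, 1).

Definition is_edge (e : vertex * vertex) : bool :=
  (val e.2 == val e.1 + theta_l) || (val e.2 == val e.1 + theta_r).

Definition edge : Type := {e : vertex * vertex | is_edge e}.

Definition source (e : edge) : vertex := (val e).1.
Definition target (e : edge) : vertex := (val e).2.

Definition vheight (v : vertex) : int := (val v).2.
Definition eheight (e : edge) : int :=
  Num.max (vheight (source e)) (vheight (target e)).

Definition boundary : set vertex := [set v | vheight v = 0].

Definition origin : vertex := exist _ (0, 0) isT.

(* [oriented_path x g y]: the edges of [g] are consecutive and lead from [x]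
   to [y]. The empty path leads from every vertex to itself, so that a boundary
   vertex is at distance 0 from the boundary. *)
Fixpoint oriented_path (x : vertex) (g : seq edge) (y : vertex) : Prop :=
  match g with
  | [::] => x = y
  | e :: g' => source e = x /\ oriented_path (target e) g' y
  end.

Definition reachable (x y : vertex) : Prop := exists g, oriented_path x g y.

Definition path_length (R : realType) (w : edge -> R) (g : seq edge) : R :=
  \sum_(e <- g) w e.

(* Every step raises the height by 1, so only finitely many oriented paths join
   two given vertices and only finitely many boundary vertices reach a given
   vertex: the infima below are minima of finite sets. The set in [fpp_dist]
   is nonempty when [reachable x y]; the one in [dist_boundary] always is. *)
Definition fpp_dist (R : realType) (w : edge -> R) (x y : vertex) : R :=
  inf [set path_length w g | g in [set g | oriented_path x g y]].

Definition dist_boundary (R : realType) (w : edge -> R) (y : vertex) : R :=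
  inf [set fpp_dist w x y | x in [set x | boundary x /\ reachable x y]].

Definition geodesic_tree (R : realType) (w : edge -> R) (x : vertex) :
    set edge :=
  [set e | exists y g, [/\ oriented_path x g y,
                           path_length w g = dist_boundary w y & e \in g]].

Definition mutually_independent d (T : measurableType d) (R : realType)
    (P : probability T R) (I : choiceType) (X : I -> {RV P >-> R}) : Prop :=
  forall (J : {fset I}) (B : I -> set R), (forall i, measurable (B i)) ->
    P (\bigcap_(i in [set` J]) (X i @^-1` B i)) =
    (\prod_(i <- J) P (X i @^-1` B i))%E.

(* The comparison is on measurable sets only, since measures are total
   functions whose values elsewhere are meaningless. *)
Definition exponentially_distributed d (T : measurableType d) (R : realType)
    (P : probability T R) (X : {RV P >-> R}) (rate : R) : Prop :=
  forall A : set R, measurable A ->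
    distribution P X A = exponential_prob rate A.

(* Main.v *)
(* Every vertex inherits a root on the boundary from its cheaper parent, and the
   descendants of 0 at height n form an interval. By translation invariance this
   interval has mean size 1, so it is wider than K with probability at most 1/K;
   in the same way, the vertices next to it are at distance more than K 2^n with
   probability at most 24/K. Otherwise, the weights at heights n + 1, ..., n + K,
   which are of order 2^n and independent of what lies below, make two cheap
   barriers close over the interval with a probability bounded below in terms of
   K only. If the tree survived with probability q > 0, then for K = O(1/q) the
   survival probability would drop by a fixed amount every K levels. *)
Require Import Defs.
From HB Require Import structures.
From mathcomp Require Import all_boot all_order all_algebra.
From mathcomp Require Import finmap zify ring lra.
From mathcomp Require Import all_classical all_reals all_analysis.
From mathcomp Require Import measurable_realfun.

Set Implicit Arguments.
Unset Strict Implicit.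
Unset Printing Implicit Defensive.

Import Order.TTheory GRing.Theory Num.Theory.
Import numFieldNormedType.Exports.

Local Open Scope classical_set_scope.
Local Open Scope ring_scope.

(** * Product spaces *)

(** The argument runs on the canonical space of weight configurations, where shifting columns and
    freezing coordinates are maps; a given family of weights enters only through its image law. The
    interval of descendants sits at a random place, so independence cannot be applied to it
    directly: the event is split according to the leftmost descendant [- j]. Each piece depends only
    on edges leaving levels below [n], and for fixed [j] the barrier edges form a fixed finite set
    of edges leaving levels [n] and above. Doubling the means lets one [K] serve all levels:
    distances at level [n] and the weights of the next [K] levels live on the scale [2 ^+ n], up to
    factors depending on [K]. The tree collects all minimizing paths, whereas [ancestor] follows one
    rule for ties; the two agree off the null event of a tie. *)

Lemma prode_ge (R : realType) (I : eqType) (J : seq I) (x : I -> \bar R) (p : R) :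
  0 <= p -> (forall i, i \in J -> (p%:E <= x i)%E) ->
  ((p ^+ size J)%:E <= \prod_(i <- J) x i)%E.
Proof.
move=> p0; elim: J => [|i J IHJ] xp; first by rewrite big_nil expr0.
rewrite big_cons /= exprS EFinM; apply: lee_pmul.
- by rewrite lee_fin.
- by rewrite lee_fin exprn_ge0.
- by apply: xp; rewrite mem_head.
- by apply: IHJ => j jJ; apply: xp; rewrite inE jJ orbT.
Qed.

Lemma negligible_countable_bigcup d (T : measurableType d) (R : realType)
    (mu : {measure set T -> \bar R}) (I : countType) (F : I -> set T) :
  (forall i, mu.-negligible (F i)) -> mu.-negligible (\bigcup_i F i).
Proof.
move=> F0; pose G k := if choice.unpickle k is Some i then F i else set0.
apply: (@negligibleS _ _ _ _ (\bigcup_k G k)) => [t [i _ Fit]|].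
  by exists (choice.pickle i) => //; rewrite /G choice.pickleK.
apply: negligible_bigcup => k; rewrite /G; case: choice.unpickle => [i|].
  exact: F0.
exact: negligible_set0.
Qed.

Section ProductSpace.
Variables (I : choiceType) (R : realType).
Implicit Types (J K : seq I) (B : I -> set R).

Definition rect J B : set (I -> R) := [set w | forall i, i \in J -> B i (w i)].

Definition rects : set (set (I -> R)) :=
  [set A | exists J B, (forall i, measurable (B i)) /\ A = rect J B].

Definition product_space := g_sigma_algebraType rects.

Lemma rects_setI_closed : setI_closed rects.
Proof.
move=> _ _ [J [B [mB ->]]] [J' [B' [mB' ->]]].
exists (J ++ J'), (fun i => (if i \in J then B i else setT) `&`
                            (if i \in J' then B' i else setT)).
split=> [i|]; first by apply: measurableI; case: ifP.
apply/seteqP; split=> w /=.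
  case=> wJ wJ' i; rewrite mem_cat => _.
  by split; case: ifP => // h; [exact: wJ|exact: wJ'].
move=> h; split=> i iJ; have := h i; rewrite mem_cat iJ ?orbT => /(_ isT) [] //.
Qed.

Lemma rectsT : rects setT.
Proof.
exists [::], (fun=> setT); split=> //.
by apply/seteqP; split=> w //= _ i; rewrite in_nil.
Qed.

Lemma measurable_rect J B : (forall i, measurable (B i)) ->
  measurable (rect J B : set product_space).
Proof. by move=> mB; apply: sub_sigma_algebra; exists J, B. Qed.

Lemma measurable_coord i : measurable_fun setT (fun w : product_space => w i).
Proof.
move=> _ B mB; rewrite setTI.
have -> : (fun w : product_space => w i) @^-1` B = rect [:: i] (fun=> B).
  apply/seteqP; split=> w /=; first by move=> Bw j; rewrite inE => /eqP ->.
  by apply; rewrite inE.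
exact: measurable_rect.
Qed.

Lemma preimage_rect T (X : T -> I -> R) J B :
  X @^-1` (rect J B) = \bigcap_(i in [set` J]) [set t | B i (X t i)].
Proof. by apply/seteqP; split=> t; apply. Qed.

Lemma measurable_to_product d (T : measurableType d) (X : T -> product_space) :
  (forall i, measurable_fun setT (fun t => X t i)) -> measurable_fun setT X.
Proof.
move=> mX; apply: (@measurability _ _ T product_space setT X rects) => //.
move=> _ [_ [J [B [mB ->]]] <-].
rewrite setTI preimage_rect; apply: fin_bigcap_measurable; first exact: finite_seq.
by move=> i _; have := mX i measurableT _ (mB i); rewrite setTI.
Qed.

Lemma product_unique (m1 m2 : {measure set product_space -> \bar R}) :
  (m1 setT < +oo)%E ->
  (forall J B, (forall i, measurable (B i)) -> m1 (rect J B) = m2 (rect J B)) ->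
  forall A, measurable A -> m1 A = m2 A.
Proof.
move=> m1oo m12 A mA.
apply: (@measure_unique _ R product_space rects (fun=> setT)) => //.
- exact: rects_setI_closed.
- by move=> _; exact: rectsT.
- by rewrite bigcup_const//; exists 0%N.
- by move=> _ [J [B [mB ->]]]; exact: m12.
Qed.

(** With a repeated index the right-hand side would count a factor twice, hence [uniq J]. *)
Definition product_law (m : set product_space -> \bar R) (q : I -> set R -> \bar R) :=
  forall J B, uniq J -> (forall i, measurable (B i)) ->
    m (rect J B) = (\prod_(i <- J) q i (B i))%E.

(** Invariance of an event under [freeze J] encodes that it depends only on the coordinates outside
    [J]. *)
Definition freeze J (w : product_space) : product_space :=
  fun i => if i \in J then 0 else w i.

Lemma measurable_freeze J : measurable_fun setT (freeze J).
Proof.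
apply: measurable_to_product => i; rewrite /freeze.
by case: (i \in J); [exact: measurable_cst|exact: measurable_coord].
Qed.

(** A constraint on a frozen coordinate is decided by whether 0 satisfies it; [undup] makes the
    remaining index list fit [product_law]. *)
Lemma freeze_rect J K B :
  (freeze J @^-1` rect K B = set0) \/
  (freeze J @^-1` rect K B = rect [seq i <- undup K | i \notin J] B).
Proof.
have [h|/existsNP[i /not_implyP[iK /not_implyP[iJ nBi]]]] :=
  pselect (forall i, i \in K -> i \in J -> B i 0).
  right; apply/seteqP; split=> w /= wK i.
    rewrite mem_filter mem_undup => /andP[iJ iK].
    by have := wK i iK; rewrite /freeze (negbTE iJ).
  move=> iK; rewrite /freeze; case: ifPn => iJ; first exact: h.
  by apply: wK; rewrite mem_filter mem_undup iJ.
by left; rewrite -subset0 => w /= /(_ _ iK); rewrite /freeze iJ.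
Qed.

Variables (m : probability product_space R) (q : I -> set R -> \bar R).
Hypothesis mq : product_law m q.

(** The image under [freeze J] of [m] restricted to [rect J B], and [m (rect J B)] times the image
    of [m], agree on rectangles because the index sets split; hence they agree on [A], which is its
    own preimage. *)
Lemma block_independence J B (A : set product_space) :
  uniq J -> (forall i, measurable (B i)) -> measurable A ->
  (forall w, A (freeze J w) <-> A w) ->
  m (A `&` rect J B) = (m A * m (rect J B))%E.
Proof.
move=> uJ mB mA fA.
have mJB : measurable (rect J B : set product_space) := measurable_rect J mB.
have mfin : m (rect J B) \is a fin_num by exact: fin_num_measure.
have r0 : 0 <= fine (m (rect J B)) by rewrite fine_ge0.
pose r := NngNum r0.
pose m1_ : {measure set product_space -> \bar R} := pushforward (mrestr m mJB) (freeze J).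
pose m2_ : {measure set product_space -> \bar R} := mscale r (pushforward m (freeze J)).
pose m1 := m1_ (measurable_freeze J); pose m2 := m2_ (measurable_freeze J).
have AE : freeze J @^-1` A = A by apply/seteqP; split=> w /= /fA.
have : m1 A = m2 A.
  apply: product_unique => //.
    have -> : m1 setT = m (rect J B).
      by rewrite /m1 /m1_ /= /pushforward /mrestr /= preimage_setT setTI.
    by rewrite -ge0_fin_numE.
  move=> K B' mB'; rewrite /m1 /m1_ /m2 /m2_ /= /mscale /= /pushforward /= /mrestr /=.
  rewrite fineK// muleC.
  have [->|->] := freeze_rect J K B'; first by rewrite set0I measure0 mul0e.
  set K' := [seq i <- undup K | i \notin J].
  have uK' : uniq K' by rewrite filter_uniq// undup_uniq.
  have dK' i : i \in K' -> i \notin J by rewrite mem_filter => /andP[].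
  have -> : rect K' B' `&` rect J B =
      rect (K' ++ J) (fun i => if i \in J then B i else B' i).
    apply/seteqP; split=> w /=.
      case=> wK wJ i; rewrite mem_cat; case: ifP => iJ; first by move=> _; exact: wJ.
      by rewrite orbF; exact: wK.
    move=> h; split=> i iJ; have := h i; rewrite mem_cat iJ ?orbT => /(_ isT) //.
    by rewrite (negbTE (dK' _ iJ)).
  rewrite !mq//; last 2 first.
  - by rewrite cat_uniq uK' uJ andbT; apply/hasPn => i iJ; apply: contraL iJ; exact: dK'.
  - by move=> i; case: ifP.
  rewrite big_cat/=; congr (_ * _)%E.
    by apply: eq_big_seq => i iK'; rewrite (negbTE (dK' _ iK')).
  by apply: eq_big_seq => i ->.
rewrite /m1 /m1_ /m2 /m2_ /= /mscale /= /pushforward /= /mrestr /= AE => ->.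
by rewrite fineK// muleC.
Qed.

End ProductSpace.

(** * Minimizing paths on the lattice *)

(* [(i, n)] stands for the vertex [(2 * i + n, n)], and [(i, n, b)] for the edge
   leaving it to the right, towards [(i, n.+1)], when [b] holds, and to the left,
   towards [(i - 1, n.+1)], otherwise. *)
Definition site : Type := (int * nat * bool)%type.

Section Deterministic.
Variable R : realType.
Implicit Types (w : site -> R) (n m : nat) (i j k : int).

(** Recursion on the last edge: [(i, m.+1)] is entered from [(i, m)] by a step to the right and from
    [(i + 1, m)] by a step to the left. [dist_boundaryE] identifies this with the distance to the
    boundary. *)
Fixpoint dist w n i : R :=
  if n is m.+1 then
    Num.min (dist w m i + w (i, m, true)) (dist w m (i + 1) + w (i + 1, m, false))
  else 0.

Definition turns_left w m i : bool :=
  dist w m (i + 1) + w (i + 1, m, false) < dist w m i + w (i, m, true).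

(** The number of left steps on the selected geodesic: a right step keeps the column, a left step
    lowers it by 1. A natural number at most [n], it indexes the possible descendants of a boundary
    vertex. *)
Fixpoint offset w n i : nat :=
  if n is m.+1 then
    if turns_left w m i then (offset w m (i + 1)).+1 else offset w m i
  else 0%N.

(* The boundary vertex from which [(i, n)] descends when ties between the two
   parents are broken in favour of the edge to the right. *)
Definition ancestor w n i : int := i + (offset w n i)%:Z.

Definition alive w n : Prop := exists i, ancestor w n i = 0.

Lemma ancestorS w n i :
  ancestor w n.+1 i = ancestor w n (if turns_left w n i then i + 1 else i).
Proof. by rewrite /ancestor /=; case: ifP => // _; rewrite -addn1 PoszD; lia. Qed.

(** Geodesics do not cross: for [i < j] the parent of [i] is at most [i + 1], hence at most [j],
    hence at most the parent of [j]. *)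
Lemma ancestor_mono w n : {homo ancestor w n : i j / i <= j}.
Proof.
elim: n => [|n IHn] i j; first by rewrite /ancestor /=; lia.
rewrite le_eqVlt => /predU1P[->//|ij]; rewrite !ancestorS; apply: IHn.
by do 2 case: ifP => _; lia.
Qed.

Lemma aliveS w n : alive w n.+1 -> alive w n.
Proof. by case=> i; rewrite ancestorS => ri; eexists; exact: ri. Qed.

Lemma alive_anti w m n : (m <= n)%N -> alive w n -> alive w m.
Proof.
move=> mn; rewrite -(subnKC mn); elim: (n - m)%N => [|k IHk]; first by rewrite addn0.
by rewrite addnS => /aliveS.
Qed.

Lemma offset_le w n i : (offset w n i <= n)%N.
Proof. by elim: n i => //= n IHn i; case: ifP => _; [rewrite ltnS|apply: leqW]. Qed.

Definition translate k w : site -> R := fun e => w (e.1.1 + k, e.1.2, e.2).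

Lemma dist_translate k w n i : dist (translate k w) n i = dist w n (i + k).
Proof.
elim: n i => //= n IHn i; rewrite !IHn /translate /=.
by rewrite -!addrA (addrC 1 k).
Qed.

Lemma offset_translate k w n i :
  offset (translate k w) n i = offset w n (i + k).
Proof.
elim: n i => //= n IHn i; rewrite !IHn /turns_left !dist_translate /translate /=.
by rewrite -!addrA (addrC 1 k).
Qed.

Lemma eq_dist w w' n i :
  (forall j m b, (m < n)%N -> w (j, m, b) = w' (j, m, b)) ->
  dist w n i = dist w' n i.
Proof.
elim: n i => //= n IHn i ww'; have ww n' : (n' < n)%N -> (n' < n.+1)%N by lia.
by rewrite !IHn ?ww'// => j m b /ww; exact: ww'.
Qed.

Lemma eq_offset w w' n i :
  (forall j m b, (m < n)%N -> w (j, m, b) = w' (j, m, b)) ->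
  offset w n i = offset w' n i.
Proof.
elim: n i => //= n IHn i ww'; have ww n' : (n' < n)%N -> (n' < n.+1)%N by lia.
have ww'n j m b : (m < n)%N -> w (j, m, b) = w' (j, m, b) by move=> /ww; exact: ww'.
by rewrite /turns_left !IHn// !(eq_dist _ ww'n) !ww'.
Qed.

Lemma dist_ge0 w n i : (forall e, 0 <= w e) -> 0 <= dist w n i.
Proof.
by move=> w0; elim: n i => //= n IHn i; rewrite le_min !addr_ge0.
Qed.

Lemma dist_le_right w n i : dist w n.+1 i <= dist w n i + w (i, n, true).
Proof. by rewrite /= ge_min lexx. Qed.

Lemma dist_le_left w n i :
  dist w n.+1 i <= dist w n (i + 1) + w (i + 1, n, false).
Proof. by rewrite /= ge_min lexx orbT. Qed.

(* Two barriers, one starting at each side of the interval of level-n vertices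
   whose ancestor is 0, run towards each other and meet after K steps: cheap edges
   along the barriers, expensive edges for stepping out of the enclosed
   triangle. *)
Definition cheap (n K : nat) (a : int) (e : site) : bool :=
  if e.2 then e.1.1 < a else a + K%:Z <= e.1.1 + (e.1.2 - n)%:Z.

(** After [j < K] steps a barrier vertex is at distance at most [(K + j) * s], so its next cheap
    edge arrives within [2 * K * s], while the competing edge alone costs more than
    [(2 * K + 1) * s]. Each barrier thus keeps its ancestor on its side of 0. After [K] steps the
    barriers occupy the adjacent columns [a - 1] and [a], and monotonicity leaves no room for
    ancestor 0. *)
Lemma barriers_meet w n K a (s : R) :
  (forall e, 0 <= w e) ->
  (forall j m b, (n <= m < n + K)%N -> a - 1 <= j <= a + K%:Z ->
     if cheap n K a (j, m, b) then w (j, m, b) <= s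
     else (K.*2.+1)%:R * s < w (j, m, b)) ->
  0 <= s ->
  dist w n (a - 1) <= K%:R * s -> dist w n (a + K%:Z) <= K%:R * s ->
  ancestor w n (a - 1) < 0 -> 0 < ancestor w n (a + K%:Z) ->
  ~ alive w (n + K).
Proof.
move=> w0 wJ s0 da db ra rb.
have L (j : nat) : (j <= K)%N ->
    dist w (n + j) (a - 1) <= (K + j)%:R * s /\ ancestor w (n + j) (a - 1) < 0.
  elim: j => [|j IHj] jK; first by rewrite !addn0.
  have [IHd IHr] := IHj (ltnW jK).
  have r1 : w (a - 1, (n + j)%N, true) <= s.
    by have := wJ (a - 1) (n + j)%N true; rewrite /cheap /= ifT; [apply; lia|lia].
  have l1 : (K.*2.+1)%:R * s < w (a, (n + j)%N, false).
    by have := wJ a (n + j)%N false; rewrite /cheap /= ifF; [apply; lia|lia].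
  split; rewrite addnS.
    apply: le_trans (dist_le_right _ _ _) _.
    by rewrite addnS -natr1 mulrDl mul1r lerD.
  rewrite ancestorS ifF// /turns_left subrK; apply/negbTE; rewrite -leNgt.
  have := dist_ge0 (n + j) a w0.
  have : (K + j)%:R * s + s <= (K.*2.+1)%:R * s.
    by rewrite -[X in _ + X]mul1r -mulrDl natr1 ler_wpM2r// ler_nat; lia.
  by move: IHd r1 l1; lra.
have U (j : nat) : (j <= K)%N ->
    dist w (n + j) (a + K%:Z - j%:Z) <= (K + j)%:R * s /\
    0 < ancestor w (n + j) (a + K%:Z - j%:Z).
  elim: j => [|j IHj] jK; first by rewrite !addn0 subr0.
  have [IHd IHr] := IHj (ltnW jK).
  set b := a + K%:Z - j%:Z in IHd IHr.
  have -> : a + K%:Z - j.+1%:Z = b - 1 by rewrite /b; lia.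
  have r1 : (K.*2.+1)%:R * s < w (b - 1, (n + j)%N, true).
    by have := wJ (b - 1) (n + j)%N true; rewrite /cheap /= ifF; [apply; lia|lia].
  have l1 : w (b, (n + j)%N, false) <= s.
    by have := wJ b (n + j)%N false; rewrite /cheap /= ifT; [apply; lia|lia].
  have lt1 : (K + j)%:R * s + s <= (K.*2.+1)%:R * s.
    by rewrite -[X in _ + X]mul1r -mulrDl natr1 ler_wpM2r// ler_nat; lia.
  split; rewrite addnS.
    apply: le_trans (dist_le_left _ _ _) _.
    by rewrite subrK addnS -natr1 mulrDl mul1r lerD.
  rewrite ancestorS ifT// /turns_left ?subrK//.
  have := dist_ge0 (n + j) (b - 1) w0.
  by move: IHd r1 l1 lt1; lra.
have [_ La] := L K (leqnn K); have [_ Ua] := U K (leqnn K).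
case=> i ri; rewrite addrK in Ua.
have [ia|ia] := leP i (a - 1).
  by have := ancestor_mono w (n + K) ia; rewrite ri; lia.
have ia' : a <= i by lia.
by have := ancestor_mono w (n + K) ia'; rewrite ri leNgt Ua.
Qed.

End Deterministic.

(** * Mass transport *)

Section Exponential.
Variables (R : realType) (r : R).
Hypothesis r0 : 0 < r.
Local Notation mu := lebesgue_measure.

Lemma exponential_prob_lt0 : exponential_prob r `]-oo, (0 : R)[ = 0%E.
Proof.
rewrite /exponential_prob integral0_eq// => x /=; rewrite in_itv/= => x0.
by rewrite lt0_exponential_pdf.
Qed.

Lemma exponential_prob_le_lebesgue (A : set R) : measurable A ->
  (exponential_prob r A <= r%:E * mu A)%E.
Proof.
move=> mA; rewrite /exponential_prob -integral_cst//.
apply: ge0_le_integral => //=.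
- by move=> x _; rewrite lee_fin exponential_pdf_ge0// ltW.
- apply/measurable_EFinP; apply: measurable_funTS; exact: measurable_exponential_pdf.
- move=> x _; rewrite lee_fin; have [x0|x0] := leP 0 x.
    rewrite exponential_pdfE// ler_piMr ?(ltW r0)//.
    by rewrite -expR0 ler_expR mulNr oppr_le0 mulr_ge0// ltW.
  by rewrite lt0_exponential_pdf// ltW.
Qed.

Lemma expRN_le_inv (z : R) : 0 < z -> expR (- z) <= z^-1.
Proof.
move=> z0; rewrite expRN lef_pV2 ?posrE ?expR_gt0//.
by apply: le_trans (expR_ge1Dx z); rewrite lerDr.
Qed.

End Exponential.

Section Model.
Variable R : realType.
Local Notation Omega := (product_space site R).
Implicit Types (n : nat) (i j k : int).

(** An edge leaving level [n] has height [n.+1]. *)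
Definition rate n : R := (2 ^+ n.+1)^-1.

Lemma rate_gt0 n : 0 < rate n.
Proof. by rewrite invr_gt0 exprn_gt0. Qed.

Lemma measurable_translate k : measurable_fun setT (translate k : Omega -> Omega).
Proof. by apply: measurable_to_product => e; exact: measurable_coord. Qed.

Lemma measurable_dist n i : measurable_fun setT (fun w : Omega => dist w n i).
Proof.
elim: n i => [|n IHn] i /=; first exact: measurable_cst.
by apply: measurable_minr; apply: measurable_funD => //; exact: measurable_coord.
Qed.

Lemma measurable_turns_left n i :
  measurable_fun setT (fun w : Omega => turns_left w n i).
Proof.
by apply: measurable_fun_ltr; apply: measurable_funD;
  (exact: measurable_dist || exact: measurable_coord).
Qed.

Lemma measurable_offset n i : measurable_fun setT (fun w : Omega => offset w n i).
Proof.
elim: n i => [|n IHn] i /=; first exact: measurable_cst.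
apply: measurable_fun_ifT => //; first exact: measurable_turns_left.
have -> : (fun w : Omega => (offset w n (i + 1)).+1) = (fun w => offset w n (i + 1) + 1)%N.
  by apply/funext => w; rewrite addn1.
by apply: measurable_fun_addn => //; exact: measurable_cst.
Qed.

Lemma measurable_ancestor n i (D : set int) :
  measurable [set w : Omega | D (ancestor w n i)].
Proof.
have /(_ [set k : nat | D (i + k%:Z)]) := measurable_offset n i measurableT.
by rewrite setTI; apply.
Qed.

Lemma measurable_dist_le n i (s : R) : measurable [set w : Omega | dist w n i <= s].
Proof.
have /(_ `]-oo, s]%classic) := measurable_dist n i measurableT.
by rewrite setTI; apply; exact: measurable_itv.
Qed.

Lemma measurable_dist_gt n i (s : R) : measurable [set w : Omega | s < dist w n i].
Proof.
have -> : [set w : Omega | s < dist w n i] = ~` [set w : Omega | dist w n i <= s].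
  by apply/seteqP; split=> w /=; rewrite ltNge => /negP.
by apply: measurableC; exact: measurable_dist_le.
Qed.

Lemma aliveP (w : Omega) n : alive w n <-> exists j : nat, ancestor w n (- j%:Z) = 0.
Proof.
split=> [[i ri]|[j rj]]; last by exists (- j%:Z).
exists (offset w n i).
by have <- : i = - (offset w n i)%:Z by move: ri; rewrite /ancestor; lia.
Qed.

Lemma measurable_alive n : measurable [set w : Omega | alive w n].
Proof.
have -> : [set w : Omega | alive w n] = \bigcup_j [set w | ancestor w n (- j%:Z) = 0].
  by apply/seteqP; split=> w /=; rewrite aliveP; [case=> j; exists j|case=> j _; exists j].
by apply: bigcup_measurable => j _; exact: (measurable_ancestor n _ [set 0]).
Qed.

Variable m : probability Omega R.
Hypothesis m_law : product_law m (fun e => exponential_prob (rate e.1.2)).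

Lemma coord_law e (A : set R) : measurable A ->
  m [set w | A (w e)] = exponential_prob (rate e.1.2) A.
Proof.
move=> mA; have := @m_law [:: e] (fun=> A) isT (fun=> mA).
rewrite big_seq1 => <-; congr (m _); apply/seteqP; split=> w /=.
  by move=> Aw e'; rewrite inE => /eqP ->.
by apply; rewrite inE.
Qed.

Lemma measurable_coord_in e (A : set R) : measurable A ->
  measurable [set w : Omega | A (w e)].
Proof. by move=> mA; have := measurable_coord e measurableT mA; rewrite setTI. Qed.

Lemma coord_lt0 e : m [set w | w e < 0] = 0%E.
Proof.
by rewrite -(exponential_prob_lt0 (rate e.1.2)) -coord_law.
Qed.

Lemma coord_le e (s : R) : 0 < s ->
  m [set w | w e <= s] = (1 - expR (- rate e.1.2 * s))%:E.
Proof.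
move=> s0; rewrite EFinB -exponential_prob_itv0c// -coord_law//.
have -> : [set w : Omega | w e <= s] =
    [set w | `]-oo, (0 : R)[%classic (w e)] `|` [set w | `[0, s]%classic (w e)].
  apply/seteqP; split=> w /=; rewrite !in_itv/=.
    by have [|] := ltP (w e) 0; [left|right].
  by case=> [h|/andP[]//]; exact: le_trans (ltW h) (ltW s0).
rewrite measureU; first 1 last.
- exact: measurable_coord_in.
- exact: measurable_coord_in.
- rewrite -subset0 => w /=; rewrite !in_itv/= => -[h /andP[]]; by rewrite leNgt h.
by rewrite [X in (X + _)%E]coord_law// exponential_prob_lt0 add0e.
Qed.

Lemma coord_gt e (s : R) : 0 < s ->
  m [set w | s < w e] = (expR (- rate e.1.2 * s))%:E.
Proof.
move=> s0; have -> : [set w : Omega | s < w e] = ~` [set w | w e <= s].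
  by apply/seteqP; split=> w /=; rewrite ltNge => /negP.
rewrite probability_setC ?coord_le// -?EFinB; first by congr (_%:E); ring.
exact: (@measurable_coord_in e `]-oo, s]%classic (measurable_itv _)).
Qed.

(** The rate depends on the level only, so a shift of columns reindexes the product over a rectangle
    without changing its factors. *)
Lemma translation_invariance k (A : set Omega) : measurable A ->
  m (translate k @^-1` A) = m A.
Proof.
pose m1_ : {measure set Omega -> \bar R} := pushforward m (translate k : Omega -> Omega).
pose m1 := m1_ (measurable_translate k).
move=> mA; have -> : m (translate k @^-1` A) = m1 A by [].
apply: product_unique => //.
  by rewrite /m1 /m1_ /= /pushforward preimage_setT probability_setT ltry.
move=> J B mB; rewrite /m1 /m1_ /= /pushforward.
have rectu B' : rect J B' = rect (undup J) B' :> set Omega.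
  by apply/seteqP; split=> w /= h e eJ; apply: h; rewrite mem_undup in eJ *.
rewrite rectu (m_law (undup_uniq J) mB).
pose sh (e : site) : site := (e.1.1 + k, e.1.2, e.2).
pose hs (e : site) : site := (e.1.1 - k, e.1.2, e.2).
have shK : cancel sh hs by move=> [[i n] b]; rewrite /sh /hs /= addrK.
have -> : translate k @^-1` rect (undup J) B =
    rect (map sh (undup J)) (fun e => B (hs e)) :> set Omega.
  apply/seteqP; split=> w /= h e.
    by case/mapP => e' e'J ->; rewrite shK; exact: h.
  by move=> eJ; have := h (sh e) (map_f sh eJ); rewrite shK.
rewrite m_law//; first last.
  by rewrite map_inj_uniq ?undup_uniq//; exact: can_inj shK.
by rewrite big_map; apply: eq_bigr => e _; rewrite shK.
Qed.

(* Summing over the descendants of 0 is, by invariance, summing over the possible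
   roots of a single vertex. *)
Lemma mass_transport n (c : int) (C : set Omega) : measurable C ->
  (m [set w : Omega | (exists i, ancestor w n (i + c) = 0 /\ C (translate i w))%R]
   <= m C)%E.
Proof.
move=> mC.
pose H (j : nat) := [set w : Omega | offset w n c = j] `&` C.
(* A vertex with ancestor 0 and offset [j] sits in column [- j]. Shifting that column to [c] turns
   the contribution of each [j] into [H j], and the [H j] are disjoint subsets of [C]. *)
have mH (j : nat) : measurable (H j).
  apply: measurableI => //.
  have := measurable_ancestor n c [set c + j%:Z]; congr measurable.
  by apply/seteqP; split=> w /=; rewrite /ancestor; lia.
pose F (j : nat) : set Omega := translate (- j%:Z - c) @^-1` H j.
have mF (j : nat) : measurable (F j).
  by rewrite -[F j]setTI; exact: measurable_translate.
set A := [set w | _].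
have AE : A = \bigcup_j F j.
  apply/seteqP; split=> w /=.
    case=> i [ri Ci]; exists (offset w n (i + c)) => //; rewrite /F /H /=.
    have -> : - (offset w n (i + c))%:Z - c = i by move: ri; rewrite /ancestor; lia.
    by rewrite offset_translate (addrC c).
  case=> j _ [/= oj Cj]; exists (- j%:Z - c); split=> //.
  by move: oj; rewrite offset_translate /ancestor (addrC c) => ->; lia.
have bound : (m (\bigcup_j F j) <= \sum_(j <oo) m (F j))%E.
  by apply: measure_sigma_subadditive => //; exact: bigcupT_measurable.
rewrite AE; apply: (le_trans bound).
under eq_eseriesr do rewrite translation_invariance//.
rewrite -measure_semi_bigcup//; first last.
- exact: bigcupT_measurable.
- apply/trivIsetP => i j _ _ ij; rewrite -subset0 => w.
  by case=> -[/= h1 _] [/= h2 _]; move: ij; rewrite -h1 -h2 eqxx.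
apply: le_measure; rewrite ?inE//; first exact: bigcupT_measurable.
by move=> w [j _ []].
Qed.

(** Only the edge to the right is followed: [K * 2 ^+ n.+1] is split into [3 / 2 * K * 2 ^+ n] for
    the distance and [K / 2 * 2 ^+ n] for the weight, whose tail is [expR (- K / 4)], at most
    [4 / K]. The constant 12 solves [c = 2 / 3 * c + 4]. *)
Lemma dist_tail n i (K : R) : 0 < K ->
  (m [set w : Omega | (K * 2 ^+ n < dist w n i)%R] <= (12 / K)%:E)%E.
Proof.
elim: n i K => [|n IHn] i K K0 /=.
  have -> : [set w : Omega | K * 2 ^+ 0 < 0] = set0.
    by rewrite -subset0 => w /=; rewrite expr0 mulr1 ltNge ltW.
  by rewrite measure0 lee_fin divr_ge0// ltW.
have K0' : 0 < 3 / 2 * K by lra.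
pose e : site := (i, n, true).
have s0 : 0 < K / 2 * 2 ^+ n by rewrite mulr_gt0 ?exprn_gt0//; lra.
have m2 : measurable [set w : Omega | K / 2 * 2 ^+ n < w e].
  have := @measurable_coord_in e `]K / 2 * 2 ^+ n, +oo[%classic (measurable_itv _).
  by congr measurable; apply/seteqP; split=> w /=; rewrite in_itv/= andbT.
have sub : [set w : Omega | K * 2 ^+ n.+1 < dist w n.+1 i] `<=`
    [set w : Omega | 3 / 2 * K * 2 ^+ n < dist w n i] `|`
    [set w : Omega | K / 2 * 2 ^+ n < w e].
  move=> w /= h; have [|d1] := ltP (3 / 2 * K * 2 ^+ n) (dist w n i); first by left.
  right; have := lt_le_trans h (dist_le_right w n i).
  rewrite exprS -/e; move: d1; set x := 2 ^+ n; lra.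
apply: le_trans (le_measure _ _ _ sub) _; rewrite ?inE.
- exact: (measurable_dist_gt n.+1).
- by apply: measurableU => //; exact: measurable_dist_gt.
apply: le_trans (measureU2 _ _ _) _ => //; first exact: measurable_dist_gt.
have -> : 12 / K = 12 / (3 / 2 * K) + 4 / K by field; rewrite gt_eqF.
rewrite EFinD; apply: leeD; first exact: IHn.
rewrite [X in (X <= _)%E](coord_gt e s0) lee_fin mulNr.
have -> : rate e.1.2 * (K / 2 * 2 ^+ n) = K / 4.
  rewrite /rate /= exprS; field; rewrite expf_neq0//.
by apply: le_trans (expRN_le_inv _) _; [lra|rewrite invf_div].
Qed.

End Model.

(** * Extinction *)

Section Extinction.
Variable R : realType.
Local Notation Omega := (product_space site R).
Variable m : probability Omega R.
Hypothesis m_law : product_law m (fun e => exponential_prob (rate R e.1.2)).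
Implicit Types (i c : int).

(* An interval of [K] descendants meets every residue class mod [K], so this gives
   a bound on the width without computing any expectation. *)
Lemma rare_residue n (K : nat) : (0 < K)%N ->
  exists2 r, (r < K)%N &
    (m [set w : Omega | (offset w n 0 %% K)%N = r] <= (K%:R^-1)%:E)%E.
Proof.
case: K => // K _; apply: contrapT => /forall2NP h.
pose E r := [set w : Omega | (offset w n 0 %% K.+1)%N = r].
have mE r : measurable (E r).
  have /(_ [set k : nat | (k %% K.+1)%N = r]) := @measurable_offset R n 0 measurableT.
  by rewrite setTI; apply.
have tE : trivIset setT E.
  apply/trivIsetP => r s _ _ rs; rewrite -subset0 => w [/= h1 h2].
  by move: rs; rewrite -h1 -h2 eqxx.
have : (\sum_(r < K.+1) m (E r) <= 1)%E.
  rewrite -(measure_bigsetU m mE tE).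
  by apply: probability_le1; apply: bigsetU_measurable => r _; exact: mE.
apply/negP; rewrite -ltNge.
have -> : 1%E = (\sum_(r < K.+1) (K.+1%:R^-1 : R)%:E)%E.
  by rewrite sumEFin sumr_const card_ord -[_ *+ K.+1]mulr_natr mulVf.
have lt1 (r : nat) : (r < K.+1)%N -> ((K.+1%:R^-1 : R)%:E < m (E r))%E.
  by move=> rK; case: (h r) => // /negP; rewrite -ltNge.
rewrite !big_ord_recl/=; apply: lte_leD => //.
- by rewrite sumEFin.
- exact: lt1.
- by apply: lee_sum => r _; apply: ltW; apply: lt1; exact: (ltn_ord (lift ord0 r)).
Qed.

(* [narrow n K j]: [- j] is the leftmost level-[n] descendant of the boundary
   vertex 0, there are at most [K] descendants, and the vertices at which the two
   barriers start are at distance at most [K * 2 ^+ n] from the boundary. *)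
Definition narrow n (K j : nat) : set Omega :=
  [set w | [/\ ancestor w n (- j%:Z) = 0, ancestor w n (- j%:Z - 1) < 0,
               0 < ancestor w n (- j%:Z + K%:Z),
               dist w n (- j%:Z - 1) <= K%:R * 2 ^+ n &
               dist w n (- j%:Z + K%:Z) <= K%:R * 2 ^+ n]].

Lemma measurable_narrow n K j : measurable (narrow n K j).
Proof.
have -> : narrow n K j =
  [set w : Omega | ancestor w n (- j%:Z) = 0] `&`
  ([set w : Omega | ancestor w n (- j%:Z - 1) < 0] `&`
  ([set w : Omega | 0 < ancestor w n (- j%:Z + K%:Z)] `&`
  ([set w : Omega | dist w n (- j%:Z - 1) <= K%:R * 2 ^+ n] `&`
   [set w : Omega | dist w n (- j%:Z + K%:Z) <= K%:R * 2 ^+ n]))).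
  by apply/seteqP; split=> w /=; [case|case=> ? [? [? []]]].
apply: measurableI; first exact: (measurable_ancestor n _ [set 0]).
apply: measurableI; first exact: (measurable_ancestor n _ [set x | x < 0]).
apply: measurableI; first exact: (measurable_ancestor n _ [set x | 0 < x]).
by apply: measurableI; exact: measurable_dist_le.
Qed.

Lemma trivIset_narrow n K : trivIset setT (narrow n K).
Proof.
have sym (j j' : nat) : (j < j')%N -> narrow n K j `&` narrow n K j' = set0.
  move=> jj'; rewrite -subset0 => w [[_ h _ _ _] [h' _ _ _ _]].
  have le : - j'%:Z <= - j%:Z - 1 by lia.
  by have := ancestor_mono w n le; rewrite h' leNgt h.
apply/trivIsetP => j j' _ _; rewrite neq_ltn => /orP[/sym//|/sym].
by rewrite setIC.
Qed.

Lemma alive_leftmost (w : Omega) n : alive w n ->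
  exists j : nat, ancestor w n (- j%:Z) = 0 /\ ancestor w n (- j%:Z - 1) < 0.
Proof.
move=> /aliveP aw.
have ub j : ancestor w n (- j%:Z) == 0 -> (j <= n)%N.
  by have := offset_le w n (- j%:Z); rewrite /ancestor; lia.
have ex : exists j : nat, ancestor w n (- j%:Z) == 0 by case: aw => j /eqP; exists j.
case: (ex_maxnP ex ub) => j /eqP rj jmax; exists j; split=> //.
have le : - j%:Z - 1 <= - j%:Z by lia.
rewrite lt_neqAle -{2}rj ancestor_mono// andbT; apply/negP => r0.
have : ancestor w n (- j.+1%:Z) == 0 by have -> : - j.+1%:Z = - j%:Z - 1 by lia.
by move/jmax; rewrite ltnn.
Qed.

(** If the interval exceeds [K] vertices it meets the rare residue class; otherwise a barrier starts
    too far from the boundary. In [T c C] the event [C] is seen from a vertex and a descendant of 0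
    lies [c] columns to its right: [c = 0] for the residue, [1] and [- K] for the two starting
    points. Mass transport gives [1 / K + 12 / K + 12 / K]. *)
Lemma alive_narrow n (K : nat) : (0 < K)%N ->
  (m [set w : Omega | alive w n] <=
   m (\bigcup_j narrow n K j) + (25 / K%:R)%:E)%E.
Proof.
move=> K0; have [r rK mr] := rare_residue n K0.
have KR : 0 < K%:R :> R by rewrite ltr0n.
pose T (c : int) (C : set Omega) : set Omega :=
  [set w | exists i, ancestor w n (i + c) = 0 /\ C (translate i w)].
have mT c C : measurable C -> measurable (T c C).
  move=> mC; have -> : T c C = \bigcup_(j : nat)
     ([set w : Omega | ancestor w n (- j%:Z) = 0] `&`
      (translate (- j%:Z - c) : Omega -> Omega) @^-1` C).
    apply/seteqP; split=> w /=.
      case=> i [ri Ci]; exists (offset w n (i + c)) => //.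
      have ic : - (offset w n (i + c))%:Z = i + c by move: ri; rewrite /ancestor; lia.
      by split; rewrite /= ic// addrK.
    by case=> j _ [/= rj Cj]; exists (- j%:Z - c); rewrite subrK.
  apply: bigcup_measurable => j _; apply: measurableI.
    exact: (measurable_ancestor n _ [set 0]).
  by rewrite -[X in measurable X]setTI; exact: measurable_translate.
pose C1 := [set w : Omega | (offset w n 0 %% K)%N = r].
pose C2 := [set w : Omega | K%:R * 2 ^+ n < dist w n 0].
have mC1 : measurable C1.
  have /(_ [set k : nat | (k %% K)%N = r]) := @measurable_offset R n 0 measurableT.
  by rewrite setTI; apply.
have mC2 : measurable C2 by exact: measurable_dist_gt.
have mN : measurable (\bigcup_j narrow n K j).
  by apply: bigcup_measurable => j _; exact: measurable_narrow.
have sub : [set w : Omega | alive w n] `<=`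
    \bigcup_j narrow n K j `|` (T 0 C1 `|` (T 1 C2 `|` T (- K%:Z) C2)).
  move=> w /= /alive_leftmost [j [rj rj1]].
  have ancK : ancestor w n (- j%:Z) <= ancestor w n (- j%:Z + K%:Z).
    by apply: ancestor_mono; lia.
  have [rK0|rK0] := leP (ancestor w n (- j%:Z + K%:Z)) 0.
    (* Within the interval column plus offset is 0, so column [- j + l] has offset [j - l], which
       must be [r] modulo [K]; adding [K] keeps the subtraction of [r] from truncating. *)
    right; left; set l := ((j + K - r) %% K)%N; exists (- j%:Z + l%:Z); rewrite addr0.
    have lK : (l < K)%N by rewrite ltn_mod.
    have le1 : - j%:Z <= - j%:Z + l%:Z by lia.
    have le2 : - j%:Z + l%:Z <= - j%:Z + K%:Z by lia.
    have r0 : ancestor w n (- j%:Z + l%:Z) = 0.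
      apply/eqP; rewrite eq_le (le_trans (ancestor_mono w n le2) rK0)/=.
      by rewrite -rj ancestor_mono.
    split=> //; rewrite /C1 /= offset_translate add0r.
    have off : (offset w n (- j%:Z + l%:Z) + l = j)%N.
      by move: r0; rewrite /ancestor; lia.
    have /eqP : (offset w n (- j%:Z + l%:Z) + l = r + l %[mod K])%N.
      by rewrite off /l modnDmr subnKC ?modnDr// (leq_trans (ltnW rK))// leq_addl.
    by rewrite eqn_modDr => /eqP ->; rewrite modn_small.
  have [dl|dl] := leP (dist w n (- j%:Z - 1)) (K%:R * 2 ^+ n); last first.
    right; right; left; exists (- j%:Z - 1); rewrite subrK; split=> //.
    by rewrite /C2 /= dist_translate add0r.
  have [dr|dr] := leP (dist w n (- j%:Z + K%:Z)) (K%:R * 2 ^+ n); last first.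
    right; right; right; exists (- j%:Z + K%:Z); rewrite addrK; split=> //.
    by rewrite /C2 /= dist_translate add0r.
  by left; exists j.
have mU : measurable (T 0 C1 `|` (T 1 C2 `|` T (- K%:Z) C2)).
  by apply: measurableU; [exact: mT|apply: measurableU; exact: mT].
apply: le_trans (le_measure m _ _ sub) _; rewrite ?inE.
- exact: measurable_alive.
- exact: measurableU.
apply: le_trans (measureU2 _ mN mU) _; rewrite leeD2l//.
have -> : 25 / K%:R = K%:R^-1 + (12 / K%:R + 12 / K%:R) :> R by field; rewrite gt_eqF.
rewrite EFinD; apply: le_trans (measureU2 _ _ _) _.
- exact: mT.
- by apply: measurableU; exact: mT.
apply: leeD; first exact: le_trans (mass_transport m_law n 0 mC1) mr.
rewrite EFinD; apply: le_trans (measureU2 _ _ _) _; [exact: mT|exact: mT|].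
by apply: leeD; apply: le_trans (mass_transport m_law n _ mC2) _; exact: dist_tail.
Qed.

(** Configurations are arbitrary real functions, so the sign condition of [barriers_meet] holds only
    almost surely. *)
Lemma negligible_negative : m.-negligible [set w : Omega | exists e, w e < 0].
Proof.
apply: (@negligibleS _ _ _ _ (\bigcup_e [set w : Omega | w e < 0])).
  by move=> w [e we]; exists e.
apply: negligible_countable_bigcup => e; exists [set w : Omega | w e < 0]; split=> //.
  exact: (@measurable_coord_in R e `]-oo, (0 : R)[%classic (measurable_itv _)).
exact: (coord_lt0 m_law).
Qed.

(* The edges that the barriers and the triangle between them can use. *)
Definition box n (K : nat) (a : int) : seq site := undup
  [seq (p.1, p.2, b) |
     p <- [seq (a - 1 + t%:Z, (n + l)%N) | t : nat <- iota 0 K.+2, l : nat <- iota 0 K],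
     b <- [:: true; false]].

Lemma mem_box n K a i l b : (n <= l < n + K)%N -> a - 1 <= i <= a + K%:Z ->
  (i, l, b) \in box n K a.
Proof.
move=> nl ai; rewrite mem_undup; apply/allpairsPdep; exists (i, l), b; split=> //.
  apply/allpairsPdep; exists (absz (i - (a - 1))%R), (l - n)%N; split.
  - by rewrite mem_iota; lia.
  - by rewrite mem_iota; lia.
  - by congr (_, _); lia.
by case: b.
Qed.

Lemma box_level n K a e : e \in box n K a -> (n <= e.1.2 < n + K)%N.
Proof.
rewrite mem_undup => /allpairsPdep[p [b [/allpairsPdep[t [l [_ + ->]]] _ ->]]] /=.
by rewrite mem_iota; lia.
Qed.

Lemma size_box n K a : (size (box n K a) <= K.+2 * K * 2)%N.
Proof.
by apply: leq_trans (size_undup _) _; rewrite !size_allpairs !size_iota.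
Qed.

Definition barrier n (K : nat) (a : int) (e : site) : set R :=
  if cheap n K a e then `]-oo, 2 ^+ n]%classic
  else `](K.*2.+1)%:R * 2 ^+ n, +oo[%classic.

Lemma measurable_barrier n K a e : measurable (barrier n K a e).
Proof. by rewrite /barrier; case: ifP => _; exact: measurable_itv. Qed.

(** A lower bound, uniform in [n], for the probability of one barrier constraint. At threshold
    [2 ^+ n] the exponent is [2 ^ -(l - n + 1)] for an edge leaving level [l], which lies between
    [2 ^ -K] and 1: the first bound serves cheap edges, the second expensive ones. *)
Definition edge_cost (K : nat) : R :=
  Num.min (1 - expR (- (2 ^+ K)^-1)) (expR (- (K.*2.+1)%:R)).

Lemma edge_cost_gt0 K : 0 < edge_cost K.
Proof.
rewrite lt_min expR_gt0 andbT subr_gt0 -expR0 ltr_expR oppr_lt0.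
by rewrite invr_gt0 exprn_gt0.
Qed.

Lemma edge_cost_le1 K : edge_cost K <= 1.
Proof. by rewrite ge_min lerBlDr lerDl expR_ge0. Qed.

Lemma barrier_edge_prob n K a e : (n <= e.1.2 < n + K)%N ->
  ((edge_cost K)%:E <= exponential_prob (rate R e.1.2) (barrier n K a e))%E.
Proof.
move=> /andP[ne eK]; rewrite -(coord_law m_law e (measurable_barrier _ _ _ _)).
have e0 : 0 < 2 ^+ n :> R by rewrite exprn_gt0.
have rateE : rate R e.1.2 * 2 ^+ n = (2 ^+ (e.1.2 - n).+1)^-1.
  by rewrite /rate -[in LHS](subnK ne) -addSn exprD invfM -mulrA mulVf ?mulr1.
rewrite /barrier; case: ifP => _.
- rewrite [X in (_ <= X)%E](coord_le m_law e e0) lee_fin ge_min; apply/orP; left.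
  rewrite lerD2l lerN2 ler_expR mulNr rateE lerN2 lef_pV2 ?posrE ?exprn_gt0//.
  by rewrite ler_weXn2l ?ler1n//; lia.
- have C0 : 0 < (K.*2.+1)%:R * 2 ^+ n :> R by rewrite mulr_gt0.
  have -> : [set w : Omega | `](K.*2.+1)%:R * 2 ^+ n, +oo[%classic (w e)] =
      [set w | (K.*2.+1)%:R * 2 ^+ n < w e].
    by apply/seteqP; split=> w /=; rewrite in_itv/= andbT.
  rewrite [X in (_ <= X)%E](coord_gt m_law e C0) lee_fin ge_min; apply/orP; right.
  rewrite ler_expR mulNr lerN2 mulrCA rateE ler_piMr//.
  by rewrite invf_le1 ?exprn_gt0// exprn_ege1 ?ler1n.
Qed.

Definition kill_prob (K : nat) : R := edge_cost K ^+ (K.+2 * K * 2).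

Lemma barrier_prob n K a :
  ((kill_prob K)%:E <= m (rect (box n K a) (barrier n K a)))%E.
Proof.
rewrite (m_law (undup_uniq _) (measurable_barrier n K a)).
apply: (@le_trans _ _ ((edge_cost K ^+ size (box n K a))%:E)).
  rewrite lee_fin /kill_prob; apply: ler_wiXn2l; last exact: size_box.
  - exact: ltW (edge_cost_gt0 K).
  - exact: edge_cost_le1.
apply: prode_ge => [|e eJ]; first exact: ltW (edge_cost_gt0 K).
by apply: barrier_edge_prob; exact: box_level eJ.
Qed.

Definition killed n K (j : nat) : set Omega :=
  narrow n K j `&` rect (box n K (- j%:Z)) (barrier n K (- j%:Z)).

Lemma measurable_killed n K j : measurable (killed n K j).
Proof.
apply: measurableI; first exact: measurable_narrow.
by apply: measurable_rect; exact: measurable_barrier.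
Qed.

(** [narrow n K j] is read off edges leaving levels below [n], the box contains none of these, so
    the two events are independent. *)
Lemma killed_prob n K j :
  ((kill_prob K)%:E * m (narrow n K j) <= m (killed n K j))%E.
Proof.
rewrite /killed (block_independence m_law) ?undup_uniq//.
- by rewrite muleC; apply: lee_wpmul2l => //; exact: barrier_prob.
- exact: measurable_barrier.
- exact: measurable_narrow.
move=> w; have fw (i : int) l b :
    (l < n)%N -> freeze (box n K (- j%:Z)) w (i, l, b) = w (i, l, b).
  by move=> ln; rewrite /freeze ifF//; apply/negP => /box_level /=; lia.
by rewrite /narrow /= /ancestor !(eq_dist _ fw) !(eq_offset _ fw).
Qed.

Lemma killed_dead n K j (w : Omega) : (forall e, 0 <= w e) -> killed n K j w ->
  ~ alive w (n + K).
Proof.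
move=> w0 [[r0 rl rr dl dr] wB].
apply: (@barriers_meet _ w n K (- j%:Z) (2 ^+ n)) => // i l b nl ai.
have := wB _ (mem_box b nl ai); rewrite /barrier; case: ifP => _ /=.
  by rewrite in_itv.
by rewrite in_itv/= andbT.
Qed.

(** The killed events for different [j] are disjoint, contained in survival to level [n], and
    exclude survival to level [n + K] up to the null event of a negative weight. *)
Lemma alive_step n K :
  (m [set w : Omega | alive w (n + K)] +
   (kill_prob K)%:E * m (\bigcup_j narrow n K j) <=
   m [set w : Omega | alive w n])%E.
Proof.
have kp0 : 0 <= kill_prob K by rewrite exprn_ge0// ltW// edge_cost_gt0.
have mN : forall j, measurable (narrow n K j : set Omega) by exact: measurable_narrow.
have mk := measurable_killed n K.
set U := \bigcup_j killed n K j.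
have mU : measurable U by exact: bigcupT_measurable.
have mA n' := @measurable_alive R n'.
have UA : U `<=` [set w : Omega | alive w n].
  by move=> w [j _ [[r0 _ _ _ _] _]]; exists (- j%:Z).
have le1 : ((kill_prob K)%:E * m (\bigcup_j narrow n K j) <= m U)%E.
  rewrite !measure_semi_bigcup//; first last.
  - exact: bigcupT_measurable.
  - exact: trivIset_narrow.
  - apply/trivIsetP => j j' _ _ jj'; rewrite -subset0 => w [[wj _] [wj' _]].
    have /trivIsetP/(_ j j' I I jj') := @trivIset_narrow n K.
    by rewrite -subset0; apply; split; [exact: wj|exact: wj'].
  rewrite -nneseriesZl//; apply: lee_nneseries => [j _ _|j _].
    by rewrite mule_ge0.
  exact: killed_prob.
have [N [mN' N0 subN]] := negligible_negative.
have sub : [set w : Omega | alive w (n + K)] `<=` ([set w | alive w n] `\` U) `|` N.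
  move=> w /= aw; have [wneg|wpos] := pselect (exists e, w e < 0).
    by right; exact: subN.
  left; split; first exact: alive_anti (leq_addr _ _) aw.
  case=> j _ /killed_dead; apply=> // e.
  by rewrite leNgt; apply/negP => we; apply: wpos; exists e.
have mD : measurable ([set w : Omega | alive w n] `\` U) by exact: measurableD.
have le2 : (m [set w : Omega | alive w (n + K)] <= m ([set w | alive w n] `\` U))%E.
  rewrite -(measureU0 mD mN' N0); apply: le_measure; rewrite ?inE//.
  exact: measurableU.
have -> : m [set w : Omega | alive w n] =
    (m ([set w : Omega | alive w n] `\` U) + m U)%E.
  by rewrite -measureU ?setDKU ?setDKI.
exact: leeD.
Qed.

Lemma extinction : m.-negligible [set w : Omega | forall n, alive w n].
Proof.
have mA n := @measurable_alive R n.
set A := [set w | _].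
have AE : A = \bigcap_n [set w : Omega | alive w n].
  by apply/seteqP; split=> w /= h n; [move=> _; exact: h|exact: h].
have mAA : measurable A by rewrite AE; exact: bigcapT_measurable.
apply/negligibleP => //; apply/eqP; rewrite -measure_le0 leNgt; apply/negP => A0.
have fE (B : set Omega) : measurable B -> m B = (fine (m B))%:E.
  by move=> mB; rewrite fineK// fin_num_measure.
pose q := fine (m A); pose a n := fine (m [set w : Omega | alive w n]).
have q0 : 0 < q by rewrite -lte_fin -fE.
have qa n : q <= a n.
  by rewrite -lee_fin -!fE//; apply: le_measure; rewrite ?inE// => w; apply.
(* Since survival to every level has probability at least [q], this [K] leaves at least [q / 2] for
   a narrow interval at each level. *)
have [K K0 qK] : exists2 K : nat, (0 < K)%N & 25 / K%:R <= q / 2.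
  have b0 : 0 <= 50 / q by rewrite divr_ge0// ltW.
  exists (Num.bound (50 / q)).
    by rewrite -(ltr_nat R); apply: le_lt_trans b0 (archi_boundP b0).
  have h := archi_boundP b0.
  have K0 : 0 < (Num.bound (50 / q))%:R :> R by exact: le_lt_trans b0 h.
  rewrite ler_pdivrMr// mulrAC ler_pdivlMr//.
  by move: h; rewrite ltr_pdivrMr// (mulrC q) => /ltW; lra.
set dl := kill_prob K.
have dl0 : 0 < dl by rewrite exprn_gt0// edge_cost_gt0.
have step n : a (n + K)%N <= a n - dl * (q / 2).
  have mN : measurable (\bigcup_j narrow n K j : set Omega).
    by apply: bigcupT_measurable => j; exact: measurable_narrow.
  have h1 := alive_step n K; have h2 := alive_narrow n K0.
  rewrite (fE _ (mA n)) (fE _ mN) -EFinD lee_fin -/(a n) in h2.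
  rewrite (fE _ (mA n)) (fE _ (mA (n + K)%N)) (fE _ mN) -EFinM -EFinD lee_fin
    -/(a n) -/(a (n + K)%N) -/dl in h1.
  have h3 : q / 2 <= fine (m (\bigcup_j narrow n K j)) by have := qa n; lra.
  have : dl * (q / 2) <= dl * fine (m (\bigcup_j narrow n K j)) by rewrite ler_pM2l.
  by move: h1; lra.
have iter t : a (t * K)%N <= 1 - t%:R * (dl * (q / 2)).
  elim: t => [|t IHt].
    by rewrite mul0r subr0 -lee_fin -fE//; exact: probability_le1.
  rewrite mulSnr; apply: le_trans (step _) _.
  by rewrite -[t.+1%:R]natr1 mulrDl mul1r; move: IHt; lra.
have c0 : 0 < dl * (q / 2) by rewrite mulr_gt0// divr_gt0.
have b0 : 0 <= (dl * (q / 2))^-1 by rewrite invr_ge0 ltW.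
have := archi_boundP b0; rewrite -(ltr_pM2r c0) mulVf ?gt_eqF// => h.
have := iter (Num.bound (dl * (q / 2))^-1); have := qa (Num.bound (dl * (q / 2))^-1 * K)%N.
by move: h; lra.
Qed.

(** This makes the edge entering a vertex on a minimizing path unique, so that membership in a tree
    can be read off [ancestor]. *)
Lemma no_tie n i : m.-negligible
  [set w : Omega | dist w n i + w (i, n, true) =
                   dist w n (i + 1) + w (i + 1, n, false)].
Proof.
pose e : site := (i, n, true).
pose Y (w : Omega) := dist w n (i + 1) + w (i + 1, n, false) - dist w n i.
have mY : measurable_fun setT Y.
  apply: measurable_funB; last exact: measurable_dist.
  by apply: measurable_funD; [exact: measurable_dist|exact: measurable_coord].
pose X := [set w : Omega | w e = Y w].
have mX : measurable X.
  have := measurable_fun_eqr (measurable_coord e) mY.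
  move=> /(_ measurableT [set true] I); rewrite setTI.
  by congr measurable; apply/seteqP; split=> w /= /eqP.
apply: (@negligibleS _ _ _ _ ([set w : Omega | exists e, w e < 0] `|` X)).
  by move=> w /= h; right; rewrite /X /Y /= /e; move: h; lra.
apply: negligibleU; first exact: negligible_negative.
have [N [mN N0 subN]] := negligible_negative.
(* The weight of [e] is independent of [Y] and has a bounded density: cut the line
   into cells of probability at most [eps]. *)
apply/(negligibleP _ mX)/eqP; rewrite -measure_le0; apply/lee_addgt0Pr => eps eps0.
rewrite add0e.
pose r := rate R n; have r0 : 0 < r := rate_gt0 R n.
(* A density at most [r] gives a cell of length [h] probability at most [r * h = eps]; the events
   that [Y] lies in a given cell are disjoint, so the total is at most [eps]. *)
pose h := eps / r; have h0 : 0 < h by rewrite divr_gt0.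
pose I_ (k : nat) : set R := `[h * k%:R, h * k.+1%:R[%classic.
pose F k := [set w : Omega | I_ k (Y w)] `&` rect [:: e] (fun=> I_ k).
have mI k : measurable (I_ k) by exact: measurable_itv.
have mYI k : measurable [set w : Omega | I_ k (Y w)].
  by have /(_ _ (mI k)) := mY measurableT; rewrite setTI.
have mF k : measurable (F k) by apply: measurableI => //; exact: measurable_rect.
have tYI : trivIset setT (fun k => [set w : Omega | I_ k (Y w)]).
  have sym (k k' : nat) (w : Omega) : (k < k')%N -> I_ k (Y w) -> ~ I_ k' (Y w).
    rewrite /I_ /= !in_itv/= => kk' /andP[_ h1] /andP[h2 _].
    have := le_lt_trans h2 h1; rewrite ltr_pM2l// ltr_nat; lia.
  apply/trivIsetP => k k' _ _; rewrite neq_ltn -subset0 => /orP[] kk' w [h1 h2].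
    exact: sym kk' h1 h2.
  exact: sym kk' h2 h1.
(* The cells cover only the nonnegative half-line; negative weights go into [N]. *)
have sub : X `<=` N `|` \bigcup_k F k.
  move=> w /= wY; have [we0|we0] := ltP (w e) 0; first by left; apply: subN; exists e.
  right; exists (Num.truncn (w e / h)) => //.
  have we : I_ (Num.truncn (w e / h)) (w e).
    have we0' : 0 <= w e / h by rewrite divr_ge0// ltW.
    have /andP[t1 t2] := truncn_itv we0'.
    by rewrite /I_ /= in_itv/= mulrC -ler_pdivlMr// t1/= mulrC -ltr_pdivrMr.
  by split; [rewrite /= -wY|move=> e'; rewrite inE => /eqP ->].
have mbig : measurable (\bigcup_k F k) by exact: bigcupT_measurable.
apply: (@le_trans _ _ (m (\bigcup_k F k))).
  rewrite -(measureU0 mbig mN N0) setUC; apply: le_measure; rewrite ?inE//.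
  exact: measurableU.
have bound : (m (\bigcup_k F k) <= \sum_(k <oo) m (F k))%E.
  by apply: measure_sigma_subadditive.
apply: (le_trans bound).
have Fle k : (m (F k) <= eps%:E * m [set w : Omega | I_ k (Y w)])%E.
  rewrite /F (block_independence m_law)//; last first.
    move=> w; have fw j l b : (l < n)%N -> freeze [:: e] w (j, l, b) = w (j, l, b).
      by move=> ln; rewrite /freeze inE ifF//; apply/negP => /eqP[]; lia.
    have fe : freeze [:: e] w (i + 1, n, false) = w (i + 1, n, false).
      by rewrite /freeze inE ifF//; apply/negP => /eqP[].
    by rewrite /= /Y fe !(eq_dist _ fw).
  rewrite muleC; apply: lee_wpmul2r => //.
  rewrite (m_law (J := [:: e]))// big_seq1.
  apply: le_trans (exponential_prob_le_lebesgue r0 (mI k)) _.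
  rewrite lebesgue_measure_itv/= lte_fin ltr_pM2l// ltr_nat ltnSn.
  rewrite -EFinB -EFinM lee_fin.
  suff -> : r * (h * k.+1%:R - h * k%:R) = eps by [].
  by rewrite -[k.+1%:R]natr1 /h; field; rewrite gt_eqF.
apply: (@le_trans _ _ (\sum_(k <oo) (eps%:E * m [set w : Omega | I_ k (Y w)]))%E).
  by apply: lee_nneseries.
rewrite nneseriesZl//.
rewrite -measure_semi_bigcup//; last exact: bigcupT_measurable.
rewrite -[leRHS]mule1; apply: lee_wpmul2l; first by rewrite lee_fin ltW.
by apply: probability_le1; exact: bigcupT_measurable.
Qed.

End Extinction.

(** * Geodesic trees *)

(** Coordinates inverse to [(i, n) |-> (2 * i + n, n)]: on a vertex the height is nonnegative and
    the division is exact by parity. *)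
Definition level (y : vertex) : nat := absz (val y).2.
Definition column (y : vertex) : int := (((val y).1 - (val y).2) %/ 2)%Z.

Lemma site_half_plane (i : int) (n : nat) : in_half_plane (i * 2 + n%:Z, n%:Z).
Proof.
rewrite /in_half_plane /= andbT -addrA; apply/dvdzP; exists (i + n%:Z); ring.
Qed.

Definition site_vertex (i : int) (n : nat) : vertex :=
  exist _ (i * 2 + n%:Z, n%:Z) (site_half_plane i n).

Lemma level_site_vertex i n : level (site_vertex i n) = n.
Proof. by []. Qed.

Lemma column_site_vertex i n : column (site_vertex i n) = i.
Proof. by rewrite /column /= addrK mulzK. Qed.

Lemma vertexE (y : vertex) : val y = (column y * 2 + (level y)%:Z, (level y)%:Z).
Proof.
case: y => [[a b] yP]; have := yP; rewrite /in_half_plane /= => /andP[/dvdzP[q qE] b0].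
rewrite /column /level /=; have -> : a - b = (q - b) * 2 by move: qE; lia.
by rewrite mulzK//; congr (_, _); move: qE b0; lia.
Qed.

Lemma site_vertexK (y : vertex) : site_vertex (column y) (level y) = y.
Proof. by apply: val_inj; rewrite [RHS]vertexE. Qed.

Lemma vertex_inj (y z : vertex) : column y = column z -> level y = level z -> y = z.
Proof. by move=> iE lE; rewrite -(site_vertexK y) iE lE site_vertexK. Qed.

Definition site_target (s : site) : vertex :=
  site_vertex (if s.2 then s.1.1 else s.1.1 - 1) s.1.2.+1.

Lemma site_is_edge (s : site) : is_edge (site_vertex s.1.1 s.1.2, site_target s).
Proof.
case: s => [[i n] []]; rewrite /is_edge /site_target /=.
  by apply/orP; right; rewrite xpair_eqE /=; apply/andP; split; apply/eqP; lia.
by apply/orP; left; rewrite xpair_eqE /=; apply/andP; split; apply/eqP; lia.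
Qed.

Definition site_edge (s : site) : edge :=
  exist _ (site_vertex s.1.1 s.1.2, site_target s) (site_is_edge s).

Definition edge_site (e : edge) : site :=
  (column (source e), level (source e), column (target e) == column (source e)).

Lemma edge_coords (e : edge) : level (target e) = (level (source e)).+1 /\
  (column (target e) = column (source e) \/ column (target e) = column (source e) - 1).
Proof.
case: e => -[x y] xy; rewrite /source /target /=.
move: xy => /orP[]; rewrite [val _.2]vertexE [val _.1]vertexE xpair_eqE /=;
  move=> /andP[/eqP h1 /eqP h2].
  by split; [lia|right; lia].
by split; [lia|left; lia].
Qed.

Lemma site_edgeK (e : edge) : site_edge (edge_site e) = e.
Proof.
have [le ie] := edge_coords e.
apply: val_inj => /=; rewrite [RHS]surjective_pairing; congr (_, _).
  exact: site_vertexK.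
apply: vertex_inj; rewrite /site_target ?column_site_vertex ?level_site_vertex /=.
  by case: eqP ie => [h _|ne [/ne//|h]]; exact: esym h.
by rewrite -le.
Qed.

Lemma site_siteK : cancel site_edge edge_site.
Proof.
case=> -[i n] b; rewrite /edge_site /site_edge /source /target /site_target /=.
rewrite !column_site_vertex level_site_vertex; congr (_, _, _).
by case: b; apply/eqP; lia.
Qed.

Lemma site_edge_inj : injective site_edge.
Proof. exact: can_inj site_siteK. Qed.

Lemma boundaryE (x : vertex) : boundary x <-> level x = 0%N.
Proof. by rewrite /boundary /= /vheight /level; have := vertexE x => ->/=; lia. Qed.

(** * Minimizing paths of the half-plane in site coordinates *)

Section Paths.
Variables (R : realType) (w : edge -> R).
Let u (s : site) : R := w (site_edge s).
Let D (y : vertex) : R := dist u (level y) (column y).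
Let A (y : vertex) : int := ancestor u (level y) (column y).

Lemma dist_target (e : edge) : D (target e) <= D (source e) + w e.
Proof.
have [le ie] := edge_coords e; rewrite /D le -[in w e](site_edgeK e).
rewrite -/(u (edge_site e)) /edge_site.
case: eqP ie => [-> _|ne [/ne//|iE]]; first exact: dist_le_right.
have := dist_le_left u (level (source e)) (column (target e)).
by rewrite iE subrK.
Qed.

(** An edge with equality is optimal among those entering its target; in the absence of ties it is
    the one that [turns_left] selects. *)
Lemma ancestor_target (e : edge) :
  (forall n i, dist u n i + u (i, n, true) <> dist u n (i + 1) + u (i + 1, n, false)) ->
  D (target e) = D (source e) + w e -> A (target e) = A (source e).
Proof.
move=> notie; have [le ie] := edge_coords e; rewrite /A /D le -[in w e](site_edgeK e).
rewrite -/(u (edge_site e)) /edge_site ancestorS /turns_left.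
case: eqP ie => [-> _ /= /eqP|ne [/ne//|->] /=].
  by rewrite eq_minl leNgt => /negbTE ->.
rewrite subrK => /eqP; rewrite eq_minr le_eqVlt => /predU1P[h|->]//.
have := notie (level (source e)) (column (source e) - 1); rewrite subrK.
by move/(_ (esym h)).
Qed.

Lemma dist_path (g : seq edge) (x y : vertex) :
  oriented_path x g y -> D y <= D x + path_length w g.
Proof.
elim: g x => [|e g IHg] x /= => [->|[<- /IHg]]; first by rewrite /path_length big_nil addr0.
rewrite /path_length big_cons addrA => /le_trans; apply.
by rewrite lerD2r; exact: dist_target.
Qed.

Lemma oriented_path_rcons (g : seq edge) (e : edge) (x : vertex) :
  oriented_path x g (source e) -> oriented_path x (rcons g e) (target e).
Proof. by elim: g x => [|f g IHg] x /= => [->|[fx /IHg]]. Qed.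

Lemma dist_attained (y : vertex) : exists x g,
  [/\ boundary x, oriented_path x g y & path_length w g = D y].
Proof.
elim: {y}(level y) {-2}y (erefl (level y)) => [|n IHn] y ly.
  exists y, [::]; split=> //; first exact/boundaryE.
  by rewrite /path_length big_nil /D ly.
pose s : site := if turns_left u n (column y) then (column y + 1, n, false)
                 else (column y, n, true).
have ty : target (site_edge s) = y.
  apply: vertex_inj; rewrite /target /= /site_target /s; case: (turns_left _ _ _) => /=;
    by rewrite ?column_site_vertex ?level_site_vertex ?addrK ?ly.
have Dy : D y = D (source (site_edge s)) + w (site_edge s).
  rewrite /D ly /source /= /s -/(u _); case: ifP => /= h;
    rewrite column_site_vertex level_site_vertex.
    by apply/eqP; rewrite eq_minr ltW.
  by apply/eqP; rewrite eq_minl leNgt; apply/negbT.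
have [|x [g [bx pg lg]]] := IHn (source (site_edge s)).
  by rewrite /source /= /s; case: ifP.
exists x, (rcons g (site_edge s)); split=> //.
  by rewrite -ty; exact: oriented_path_rcons.
by rewrite Dy -lg /path_length big_rcons /= addrC.
Qed.

Lemma inf_min (E : set R) (a : R) : E a -> lbound E a -> inf E = a.
Proof.
move=> Ea lE; apply/eqP; rewrite eq_le lb_le_inf ?andbT//; last by exists a.
by apply: ge_inf => //; exists a.
Qed.

(** Both infima are attained: [dist_path] bounds every path from the boundary from below, and the
    path of [dist_attained] is optimal also among paths from its own starting point. *)
Lemma dist_boundaryE (y : vertex) : dist_boundary w y = D y.
Proof.
have D0 x : boundary x -> D x = 0 by rewrite /D => /boundaryE ->.
have lb x : boundary x ->
    lbound [set path_length w g | g in [set g | oriented_path x g y]] (D y).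
  move=> bx _ [g /= pg <-]; have := dist_path pg; rewrite (D0 _ bx) add0r//.
have [x [g [bx pg lg]]] := dist_attained y.
apply: inf_min.
  exists x; first by split=> //; exists g.
  by apply: inf_min; [exists g|exact: lb].
move=> _ [x' [bx' [g' pg']] <-]; apply: lb_le_inf; last exact: lb.
by exists (path_length w g'), g'.
Qed.

(** Slack in one edge could not be recovered later, by [dist_path], so every edge of a minimizing
    path is tight and preserves the ancestor. *)
Lemma minimal_path_ancestor (g : seq edge) (x y : vertex) (e : edge) :
  (forall n i, dist u n i + u (i, n, true) <> dist u n (i + 1) + u (i + 1, n, false)) ->
  oriented_path x g y -> D y = D x + path_length w g -> e \in g ->
  A (source e) = A x.
Proof.
move=> notie; elim: g x => [|f g IHg] x //= [fx pg].
rewrite /path_length big_cons addrA => Dy; rewrite inE => /predU1P[->|eg].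
  by rewrite fx.
have Df : D (target f) = D (source f) + w f.
  apply/eqP; rewrite eq_le dist_target /=.
  by have := dist_path pg; rewrite Dy /path_length lerD2r fx.
rewrite -fx -(ancestor_target notie Df); apply: IHg => //.
by rewrite Df fx.
Qed.

(** Every edge of the tree leaves a vertex with ancestor [column x]. Extinction puts that vertex at
    a level below [N], hence its offset is below [N] too, and level, offset and direction determine
    the edge. *)
Lemma finite_geodesic_tree (x : vertex) (N : nat) :
  (forall n i, dist u n i + u (i, n, true) <> dist u n (i + 1) + u (i + 1, n, false)) ->
  ~ alive (translate (column x) u) N -> boundary x ->
  finite_set (geodesic_tree w x).
Proof.
move=> notie dead bx.
pose f (p : 'I_N * 'I_N * bool) : edge :=
  site_edge (column x - (p.1.1 : nat)%:Z, p.1.2 : nat, p.2).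
apply: (@sub_finite_set _ _ (f @` setT)); last exact/finite_image/finite_finset.
move=> e [y [g [pg lg eg]]].
rewrite dist_boundaryE in lg.
have Ax : A x = column x by rewrite /A (proj1 (boundaryE x) bx) /ancestor addr0.
have Dx : D x = 0 by rewrite /D (proj1 (boundaryE x) bx).
have : A (source e) = column x.
  by rewrite (minimal_path_ancestor notie pg _ eg)// Dx add0r.
set i := column (source e); set n := level (source e).
rewrite /A -/i -/n => an.
have nN : (n < N)%N.
  rewrite ltnNge; apply/negP => Nn; apply: dead; apply: (alive_anti Nn).
  exists (i - column x); move: an; rewrite /ancestor offset_translate subrK; lia.
have off := offset_le u n i.
have oN : (offset u n i < N)%N by exact: leq_ltn_trans off nN.
exists (Ordinal oN, Ordinal nN, (edge_site e).2) => //.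
rewrite -[RHS]site_edgeK /f /=; congr (site_edge (_, _, _)).
by move: an; rewrite /ancestor -/i; lia.
Qed.

End Paths.

(** * Transfer to a given family of weights, and measurability *)

Section Transfer.
Variables (R : realType) (d : measure_display) (T : measurableType d).
Variables (P : probability T R) (omega : edge -> {RV P >-> R}).
Local Notation Omega := (product_space site R).

Definition weights (t : T) : Omega := fun s => omega (site_edge s) t.

Lemma measurable_weights : measurable_fun setT weights.
Proof. by apply: measurable_to_product => s. Qed.

HB.instance Definition _ := isMeasurableFun.Build _ _ _ _ weights measurable_weights.

Hypothesis omega_indep : mutually_independent omega.
Hypothesis omega_exp : forall e : edge,
  exponentially_distributed (omega e) ((2%:R : R) ^ (- eheight e)).

Lemma eheight_site_edge s : eheight (site_edge s) = s.1.2.+1%:Z.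
Proof. by rewrite /eheight /vheight /source /target /=; lia. Qed.

Lemma weights_law :
  product_law (distribution P weights) (fun e => exponential_prob (rate R e.1.2)).
Proof.
move=> J B uJ mB; rewrite /distribution /pushforward.
pose K : {fset edge} := [fset site_edge s | s in J]%fset.
have memK s : (site_edge s \in K) = (s \in J).
  apply/imfsetP/idP => /= [[s' s'J /site_edge_inj ->//]|sJ].
  by exists s.
have -> : weights @^-1` rect J B = \bigcap_(e in [set` K]) (omega e @^-1` B (edge_site e)).
  apply/seteqP; split=> t /= h.
    move=> e /= eK; have := h (edge_site e); rewrite -memK site_edgeK => /(_ eK).
    by rewrite /weights site_edgeK.
  move=> s sJ; have := h (site_edge s); rewrite /= memK => /(_ sJ).
  by rewrite site_siteK.
rewrite omega_indep//.
rewrite (perm_big (map site_edge J)) ?big_map /=; last first.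
  apply: uniq_perm; rewrite ?fset_uniq ?(map_inj_uniq site_edge_inj)// => e.
  by rewrite -(site_edgeK e) memK (mem_map site_edge_inj).
apply: eq_bigr => s _; rewrite site_siteK.
have := omega_exp (site_edge s) (mB s).
by rewrite /distribution /pushforward eheight_site_edge => ->.
Qed.

Lemma negligible_preimage (A : set Omega) :
  (distribution P weights).-negligible A -> P.-negligible (weights @^-1` A).
Proof.
move=> [N [mN N0 AN]]; exists (weights @^-1` N); split=> //.
- by rewrite -[X in measurable X]setTI; exact: measurable_weights.
- exact: preimage_subset.
Qed.

(** A tie somewhere and survival from some column are countable unions of null events; off them
    every boundary vertex is handled at once. *)
Lemma negligible_infinite_tree : P.-negligible
  [set t | exists2 x, boundary x & ~ finite_set (geodesic_tree (fun e => omega e t) x)].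
Proof.
pose tie (p : nat * int) := [set w : Omega | dist w p.1 p.2 + w (p.2, p.1, true) =
  dist w p.1 (p.2 + 1) + w (p.2 + 1, p.1, false)].
pose survive (k : int) := translate k @^-1` [set w : Omega | forall n, alive w n].
have neg : (distribution P weights).-negligible (\bigcup_p tie p `|` \bigcup_k survive k).
  apply: negligibleU; apply: negligible_countable_bigcup => i.
    exact: (no_tie weights_law).
  have [N [mN N0 AN]] := extinction weights_law.
  exists (translate i @^-1` N); split.
  - by rewrite -[X in measurable X]setTI; exact: measurable_translate.
  - exact: etrans (translation_invariance weights_law i mN) N0.
  - exact: preimage_subset.
apply: negligibleS (negligible_preimage neg) => t [x bx inf].
have [[p _ tp]|notie] := pselect ((\bigcup_p tie p) (weights t)); first by left; exists p.
right; exists (column x) => // n; apply: contrapT => dead; apply: inf.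
apply: (finite_geodesic_tree (N := n)) => // n' i h.
by apply: notie; exists (n', i).
Qed.

Lemma measurable_path_length (g : seq edge) :
  measurable_fun setT (fun t => path_length (fun e => omega e t) g).
Proof.
elim: g => [|e g IHg].
  have -> : (fun t => path_length (fun e => omega e t) [::]) = cst 0.
    by apply/funext => t; rewrite /path_length big_nil.
  exact: measurable_cst.
have -> : (fun t => path_length (fun e => omega e t) (e :: g)) =
    omega e \+ (fun t => path_length (fun e => omega e t) g).
  by apply/funext => t; rewrite /path_length big_cons.
have me : measurable_fun setT (omega e) by [].
exact (measurable_funD me IHg).
Qed.

(** Endpoints and paths are countably many, and [dist_boundaryE] replaces the nested infima by the
    measurable [dist]. *)
Lemma measurable_in_tree (x : vertex) (e : edge) :
  measurable [set t | geodesic_tree (fun e => omega e t) x e].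
Proof.
pose F (p : vertex * seq edge) : set T :=
  if pselect (oriented_path x p.2 p.1 /\ e \in p.2) then
    [set t | path_length (fun e => omega e t) p.2 =
             dist (weights t) (level p.1) (column p.1)]
  else set0.
have -> : [set t | geodesic_tree (fun e => omega e t) x e] = \bigcup_p F p.
  apply/seteqP; split=> t /=.
    case=> y [g [pg lg eg]]; exists (y, g) => //; rewrite /F.
    by case: pselect => [_|h] /=; [rewrite lg dist_boundaryE|apply: h].
  case=> -[y g] _; rewrite /F; case: pselect => //= -[pg eg] lg.
  by exists y, g; split=> //; rewrite dist_boundaryE.
apply: countable_bigcupT_measurable => [|[y g]]; first exact: countableP.
rewrite /F.
case: pselect => _ //=.
have mD : measurable_fun setT (fun t => dist (weights t) (level y) (column y)).
  exact: measurableT_comp (measurable_dist _ _) measurable_weights.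
have /(_ measurableT [set true] I) := measurable_fun_eqr (measurable_path_length g) mD.
by rewrite setTI; congr measurable; apply/seteqP; split=> t /= /eqP.
Qed.

(** A set of edges is finite when some list contains it: a countable union, over lists, of countable
    intersections. *)
Lemma measurable_finite_tree (x : vertex) :
  measurable [set t | finite_set (geodesic_tree (fun e => omega e t) x)].
Proof.
have -> : [set t | finite_set (geodesic_tree (fun e => omega e t) x)] =
    \bigcup_(s : seq edge) ~` (\bigcup_(e : edge)
      ([set t | geodesic_tree (fun e => omega e t) x e] `&` [set t | e \notin s])).
  apply/seteqP; split=> t /=.
    move=> /finite_seqP[s sE]; exists s => // -[e _ [/= te /negP]]; apply.
    by move: te; rewrite sE.
  case=> s _ h; apply: (@sub_finite_set _ _ [set` s]) => // e te /=.
  by apply/negPn/negP => es; apply: h; exists e.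
apply: countable_bigcupT_measurable => [|s]; first exact: countableP.
apply: measurableC.
apply: countable_bigcupT_measurable => [|e]; first exact: countableP.
apply: measurableI.
  exact: measurable_in_tree.
by case: (e \in s) => /=; [rewrite set_false|rewrite set_true].
Qed.

End Transfer.

Theorem theorem3p1 (R : realType) (d : measure_display)
    (T : measurableType d) (P : probability T R)
    (omega : edge -> {RV P >-> R})
    (omega_indep : mutually_independent omega)
    (omega_exp : forall e : edge,
       exponentially_distributed (omega e) ((2%:R : R) ^ (- eheight e))) :
  {ae P, forall t : T, forall x : vertex, boundary x ->
     finite_set (geodesic_tree (fun e => omega e t) x)} /\
  measurable [set t : T |
     finite_set (geodesic_tree (fun e => omega e t) origin)] /\
  P [set t : T |
     finite_set (geodesic_tree (fun e => omega e t) origin)] = 1%E.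
Proof.
have neg := negligible_infinite_tree omega_indep omega_exp.
have mfin := measurable_finite_tree omega origin.
split; first by apply: negligibleS neg => t /= /existsNP[x /not_implyP[bx]]; exists x.
split=> //.
have N0 : P (~` [set t | finite_set (geodesic_tree (fun e => omega e t) origin)]) = 0%E.
  apply: measure_negligible; first exact: measurableC.
  by apply: negligibleS neg => t /= inf; exists origin.
by rewrite -[X in P X]setCK probability_setC ?N0 ?sube0//; exact: measurableC.
Qed.
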